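(* Let $\pi_1,\ldots,\pi_k$ be $k$ independent and exact valid inferential model (IM) possibility contours for a common unknown quantity of interest $\theta\in\Theta$. Let $\gamma_c:[0,1]^k\to\mathbb{R}$ be any continuous function that is monotonic in each coordinate, and let $F$ be the cumulative distribution function of $\gamma_c(U_1,\ldots,U_k)$, where $U^k=(U_1,\ldots,U_k)$ has independent and identically distributed $\mathrm{Unif}(0,1)$ components. Define, for $\vartheta\in\Theta$, $$\pi_c(\vartheta)=F\bigl(\gamma_c(\pi_1(\vartheta),\ldots,\pi_k(\vartheta))\bigr),\qquad \dot{\pi}_c(\vartheta)=\frac{\pi_c(\vartheta)}{\max_{t\in\Theta}\pi_c(t)},$$ where the maximum is understood to exist and to be positive. Then $\dot{\pi}_c$ is a valid (fused) IM possibility contour, in the sense that $$\mathbb{P}_{U^k}\bigl(\dot{\Pi}_c(\theta)\le\alpha\bigr)\le\alpha\quad\text{for all }\alpha\in[0,1],$$ where $\dot{\Pi}_c(\theta)$ denotes $\dot{\pi}_c$, regarded as a random function of the data, evaluated at the true value $\theta$.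
   Context: Setting: $\theta\in\Theta$ is an unknown quantity, and data $Y$ are drawn from a distribution $\mathbb{P}_\theta$ associated with the true value $\theta$. An IM possibility contour is a function $(y,\vartheta)\mapsto\pi_y(\vartheta)\in[0,1]$ of data $y$ and candidate value $\vartheta\in\Theta$ satisfying $\sup_{\vartheta\in\Theta}\pi_y(\vartheta)=1$ for all $y$. The contour is valid if $\mathbb{P}_\theta\{\pi_Y(\theta)\le\alpha\}\le\alpha$ for all $\alpha\in[0,1]$, where $\theta$ is the true value generating $Y$; it is exact valid if $\pi_Y(\theta)\sim\mathrm{Unif}(0,1)$ when $Y\sim\mathbb{P}_\theta$. The contours $\pi_1,\ldots,\pi_k$ are based on $k$ independent data sets (possibly of different sizes and from different models, but all associated with the same true $\theta$). The dependence on the data is suppressed in the notation: $\pi_i(\vartheta)$ is the contour for the observed $i$-th data set, and $\Pi_i(\vartheta)$ is the same quantity viewed as a random variable (a function of the random $i$-th data set). Similarly $\dot{\Pi}_c(\vartheta)$ denotes $\dot{\pi}_c(\vartheta)$ viewed as a random variable, i.e. computed from $\Pi_1,\ldots,\Pi_k$ (the maximum in the denominator being computed from the random contours as well). ''Independent and exact valid'' means that, for the true value $\theta$, the random variables $\Pi_1(\theta),\ldots,\Pi_k(\theta)$ are independent and identically distributed $\mathrm{Unif}(0,1)$. The notation $\mathbb{P}_{U^k}$ refers to probability with respect to the joint distribution of the random contours, under which $(\Pi_1(\theta),\ldots,\Pi_k(\theta))$ has the distribution of $U^k$. ''Monotonic in each coordinate'' means that $\gamma_c$ is a monotone function of each of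 its arguments when the others are held fixed. *)

(* Defs.v *)
From HB Require Import structures.
From mathcomp Require Import all_boot all_order all_algebra.
From mathcomp Require Import all_classical all_reals all_analysis.

Set Implicit Arguments.
Unset Strict Implicit.
Unset Printing Implicit Defensive.

Import Order.TTheory GRing.Theory Num.Theory.
Import numFieldNormedType.Exports.

Local Open Scope classical_set_scope.
Local Open Scope ring_scope.

(* Any data type [Y] is allowed: no sigma-algebra on it is needed. *)
Definition possibility_contour (R : realType) (Y Theta : Type)
    (pi : Y -> Theta -> R) : Prop :=
  (forall y t, 0 <= pi y t <= 1) /\ (forall y, sup (range (pi y)) = 1).

Definition uniform01 (R : realType) (d : measure_display)
    (Omega : measurableType d) (P : probability Omega R) (X : Omega -> R) :
    Prop :=
  measurable_fun setT X /\
  forall A : set R, measurable A -> P (X @^-1` A) = uniform_prob (@ltr01 R) A.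

Definition mutually_independent (R : realType) (d : measure_display)
    (Omega : measurableType d) (P : probability Omega R) (k : nat)
    (X : 'I_k -> Omega -> R) : Prop :=
  forall (J : {set 'I_k}) (A : 'I_k -> set R),
    (forall i, i \in J -> measurable (A i)) ->
    P (\bigcap_(i in [set` J]) (X i @^-1` A i)) =
      (\prod_(i in J) P (X i @^-1` A i))%E.

(* [X w] plays the role of the contour of the data [w] at the true value under
   which [P] is the law of the data.  The outer measure [mu_ext P] is used
   because a fused contour involves a maximum over an arbitrary, possibly
   uncountable, parameter space, so that the event need not be measurable; on
   measurable events [mu_ext P] is [P] (lemma [measurable_mu_extE]). *)
Definition valid (R : realType) (d : measure_display)
    (Omega : measurableType d) (P : probability Omega R) (X : Omega -> R) :
    Prop :=
  forall alpha : R, 0 <= alpha <= 1 ->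
    (mu_ext P [set w | (X w <= alpha)%R] <= alpha%:E)%E.

Definition unit_cube (R : realType) (k : nat) : set 'rV[R]_k :=
  [set x | forall i, 0 <= x ord0 i <= 1].

Definition set_coord (R : realType) (k : nat) (x : 'rV[R]_k) (i : 'I_k)
    (s : R) : 'rV[R]_k :=
  \row_j (if j == i then s else x ord0 j).

(* The direction may depend on the coordinate and on the values at which the
   other coordinates are fixed. *)
Definition coordinatewise_monotone (R : realType) (k : nat)
    (gamma : 'rV[R]_k -> R) : Prop :=
  forall (x : 'rV[R]_k) (i : 'I_k), unit_cube x ->
    {in `[0, 1] &, {homo (fun s => gamma (set_coord x i s)) : a b / a <= b}} \/
    {in `[0, 1] &, {homo (fun s => gamma (set_coord x i s)) : a b /~ a <= b}}.

(* The real-valued counterpart of the library's [cdf], which is stated for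
   bundled random variables and takes values in [\bar R]. *)
Definition distribution_function (R : realType) (d : measure_display)
    (Omega : measurableType d) (P : probability Omega R) (X : Omega -> R)
    (r : R) : R :=
  fine (P [set w | X w <= r]).

Section fusion.
Variables (R : realType) (k : nat) (Theta : Type) (Y : 'I_k -> Type).
Variables (pi : forall i, Y i -> Theta -> R) (gamma : 'rV[R]_k -> R).
Variable F : R -> R.

Definition combined (y : forall i, Y i) (t : Theta) : R :=
  F (gamma (\row_i pi (y i) t)).

Definition has_positive_max (f : Theta -> R) : Prop :=
  exists t0, (forall t, f t <= f t0) /\ 0 < f t0.

(* The supremum is the maximum whenever the latter exists. *)
Definition fused (y : forall i, Y i) (t : Theta) : R :=
  combined y t / sup (range (combined y)).

End fusion.

(* Main.v *)
Require Import Defs.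
From HB Require Import structures.
From mathcomp Require Import all_boot all_order all_algebra.
From mathcomp Require Import all_classical all_reals all_analysis.
From mathcomp Require Import measurable_realfun lra.
Import Order.TTheory GRing.Theory Num.Theory.
Import numFieldNormedType.Exports.
Local Open Scope classical_set_scope.
Local Open Scope ring_scope.

(** Write [Pi] for the random vector of the contours at the true value.  The
    maximum of the combined contour is at most [1], because the combined
    contour takes values of a distribution function; dividing by it therefore
    only increases the contour, and validity of the fused contour follows from
    validity of the combined contour [F (gamma Pi)], that is, from
    [P (F (gamma Pi) <= alpha) <= alpha].

    By independence and exactness [Pi] has the law of the uniform vector [U],
    so [gamma Pi] has distribution function [F], and the bound is the classical
    fact that the probability transform of a random variable by its own
    distribution function stochastically dominates the uniform law
    ([mu_ext_cdf_le]).

    What takes work is the equality of the laws of [gamma Pi] and [gamma U],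
    since [gamma] is only known to be continuous on the unit cube.  Laws on
    [R^k] are compared on the sigma-algebra generated by measurable boxes:
    boxes are stable under intersection and the product rule determines their
    probabilities, so two independent families with the same marginals have the
    same joint law ([eq_joint_law]).  This sigma-algebra contains the open sets
    ([open_box_measurable]), hence it cuts out on the cube the sublevel sets of
    any function continuous there ([sublevel_box_measurable]).  Both vectors
    stay in the cube, so these sublevel sets have the same probability. *)

Set Implicit Arguments.
Unset Strict Implicit.

(** * The sigma-algebra of boxes *)

Definition boxes (R : realType) (k : nat) : set (set 'rV[R]_k) :=
  [set [set x : 'rV[R]_k | forall i, A i (x ord0 i)] |
    A in [set A : 'I_k -> set R | forall i, measurable (A i)]].

(** The half-open cubes of side [1 / n.+1] with corners in the lattice
    [Z^k / n.+1]; the integer vector [m] names the lower corner. *)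
Definition grid_cell (R : realType) (k n : nat) (m : {ffun 'I_k -> int}) :
    set 'rV[R]_k :=
  [set x | forall i, Num.floor (x ord0 i * n.+1%:R) = m i].

Lemma boxes_setI_closed (R : realType) (k : nat) : setI_closed (@boxes R k).
Proof.
move=> _ _ [A mA <-] [B mB <-]; exists (fun i => A i `&` B i).
  by move=> i; exact: measurableI.
apply/seteqP; split=> x /=; first by move=> ABx; split=> i; case: (ABx i).
by move=> [Ax Bx] i; split.
Qed.

Lemma boxesT (R : realType) (k : nat) : boxes [set: 'rV[R]_k].
Proof.
exists (fun=> setT) => [i|]; first exact: measurableT.
by apply/seteqP; split.
Qed.

Lemma grid_cell_box (R : realType) (k n : nat) (m : {ffun 'I_k -> int}) :
  boxes (@grid_cell R k n m).
Proof.
exists (fun i => [set s : R | Num.floor (s * n.+1%:R) = m i]) => // i.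
apply: is_interval_measurable => s u /= hs hu t /andP[st tu].
apply/eqP; rewrite eq_le -{1}hu -{1}hs.
by apply/andP; split; apply: le_floor; rewrite ler_pM2r ?ltr0n.
Qed.

Lemma grid_cell_ball (R : realType) (k n : nat) (m : {ffun 'I_k -> int})
    (x y : 'rV[R]_k) (e : R) :
  n.+1%:R^-1 < e -> grid_cell n m x -> grid_cell n m y -> ball x e y.
Proof.
move=> ne mx my; have n0 : 0 < n.+1%:R :> R by rewrite ltr0n.
split; first by rewrite (lt_trans _ ne)// invr_gt0.
move=> i j; rewrite (ord1 i) /ball /=.
apply: le_lt_trans ne; rewrite -[leRHS]mul1r ler_pdivlMr//.
rewrite -{1}(gtr0_norm n0) -normrM mulrBl ltW// ltr_norml.
have /andP[]:= floor_itv (x ord0 j * n.+1%:R).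
have /andP[]:= floor_itv (y ord0 j * n.+1%:R).
rewrite mx my intrD; set a := (_ * _); set b := (_ * _); set c := (_%:~R).
move=> *; lra.
Qed.

(** Every point of an open set lies in a sufficiently fine grid cell contained
    in the set, and there are countably many cells over all mesh sizes. *)
Lemma open_box_measurable (R : realType) (k : nat) (V : set 'rV[R]_k) :
  open V -> <<s @boxes R k >> V.
Proof.
move=> oV.
pose I := {p : nat * {ffun 'I_k -> int} | `[< grid_cell p.1 p.2 `<=` V >]}.
have -> : V = \bigcup_(p : I) grid_cell (val p).1 (val p).2.
  apply/seteqP; split=> [x Vx|x [p _]]; last exact: (asboolP _ (valP p)).
  have /nbhs_ballP[e /= e0 eV] : nbhs x V by exact: open_nbhs_nbhs.
  have [n ne] : exists n, n.+1%:R^-1 < e.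
    exists (Num.trunc e^-1); rewrite -[ltRHS]invrK ltf_pV2 ?posrE ?invr_gt0//.
    exact: truncnS_gt.
  pose m := [ffun i => Num.floor (x ord0 i * n.+1%:R)].
  have xm : grid_cell n m x by move=> i; rewrite ffunE.
  have nmV : `[< grid_cell n m `<=` V >].
    by apply/asboolP => y /(grid_cell_ball ne xm); exact: eV.
  by exists (exist _ (n, m) nmV).
apply: (@countable_bigcupT_measurable _ (g_sigma_algebraType (@boxes R k))).
  exact: countableP.
by move=> p; apply: sub_sigma_algebra; exact: grid_cell_box.
Qed.

(** A relatively open superlevel set is the trace on [A] of an open set [V], and
    [W] is the complement of [V].  Stating the result as a trace allows [A] to
    be arbitrary. *)
Lemma sublevel_box_measurable (R : realType) (k : nat) (A : set 'rV[R]_k)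
    (g : 'rV[R]_k -> R) (r : R) :
  {within A, continuous g} ->
  exists2 W, <<s @boxes R k >> W & forall x, A x -> W x <-> g x <= r.
Proof.
move=> /continuousP/(_ _ (@open_gt R r))/open_subspaceP.
move=> [V oV /seteqP[VA AV]]; exists (~` V).
  apply: (@measurableC _ (g_sigma_algebraType (@boxes R k))).
  exact: open_box_measurable.
move=> x Ax; have gV : V x <-> r < g x.
  by split=> [Vx|rgx]; [have [] := VA x (conj Vx Ax)|
    have [] := AV x (conj rgx Ax)].
rewrite leNgt; split=> [nV|/negP nrg]; last by move=> /gV.
by apply/negP => /gV.
Qed.

(** * Joint laws of independent variables *)

Section joint_law.
Context (R : realType) (k : nat).

Lemma measurable_row d (Omega : measurableType d) (X : 'I_k -> Omega -> R) :
  (forall i, measurable_fun setT (X i)) ->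
  measurable_fun setT
    (fun w => \row_i X i w : g_sigma_algebraType (@boxes R k)).
Proof.
move=> mX; apply: (@measurability _ _ _ (g_sigma_algebraType (@boxes R k))
  _ _ (@boxes R k)) => //.
move=> _ [_ [A mA <-] <-]; rewrite setTI.
have -> : (fun w => \row_i X i w) @^-1`
      [set x : 'rV[R]_k | forall i, A i (x ord0 i)] =
    \bigcap_(i in [set: 'I_k]) (X i @^-1` A i).
  by apply/seteqP; split=> w /= Aw i; have := Aw i; rewrite mxE//; exact.
apply: fin_bigcap_measurable => // i _.
by rewrite -[X in measurable X]setTI; exact: mX.
Qed.

(** Uniqueness of measures on the intersection-stable family of boxes, whose
    probabilities factor into marginals by independence. *)
Lemma eq_joint_law (d d' : measure_display) (Omega : measurableType d)
    (Omega' : measurableType d') (P : probability Omega R)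
    (P' : probability Omega' R) (X : 'I_k -> Omega -> R)
    (X' : 'I_k -> Omega' -> R) :
  (forall i, measurable_fun setT (X i)) ->
  (forall i, measurable_fun setT (X' i)) ->
  (forall i A, measurable A -> P (X i @^-1` A) = P' (X' i @^-1` A)) ->
  mutually_independent P X -> mutually_independent P' X' ->
  forall V : set 'rV[R]_k, <<s @boxes R k >> V ->
  P [set w | V (\row_i X i w)] = P' [set w | V (\row_i X' i w)].
Proof.
move=> mX mX' eqX indX indX' V sV.
pose m := distribution P (mfun_Sub (mem_set (measurable_row mX))).
pose m' := distribution P' (mfun_Sub (mem_set (measurable_row mX'))).
have box_law d0 (W : measurableType d0) (Q : probability W R)
    (Z : 'I_k -> W -> R) A : mutually_independent Q Z ->
    (forall i, measurable (A i)) ->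
    Q [set w | forall i, A i ((\row_i Z i w) ord0 i)] =
      (\prod_(i in [set: 'I_k]%SET) Q (Z i @^-1` A i))%E.
  move=> indZ mA; rewrite -indZ//; congr (Q _).
  apply/seteqP; split=> w /= Aw i => [_|].
    by have := Aw i; rewrite mxE.
  by rewrite mxE; apply: Aw; rewrite /= inE.
apply: (@measure_unique _ _ (g_sigma_algebraType (@boxes R k))
  (@boxes R k) (fun=> setT) _ _ _ _ m m') => //=.
- exact: boxes_setI_closed.
- by move=> _; exact: boxesT.
- by rewrite bigcup_const//; exists 0%N.
- move=> _ [A mA <-]; apply: (etrans (box_law _ _ _ _ _ indX mA)).
  rewrite (eq_bigr _ (fun i _ => eqX i (A i) (mA i))).
  exact/esym/(box_law _ _ _ _ _ indX' mA).
- by move=> _; rewrite probability_setT ltry.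
Qed.

End joint_law.

(** * The probability transform *)

(** A nonempty down-set is the whole line, a closed ray or an open ray; the last
    one is the union of the rays ending at [sup S - 1 / n.+1].  The endpoints
    [q n] belong to [S], so a bound valid on [S] can be used at them. *)
Lemma down_set_bigcup (R : realType) (S : set R) :
  S !=set0 -> (forall x y, x <= y -> S y -> S x) ->
  exists2 q : nat -> R, {homo q : m n / (m <= n)%N >-> m <= n} &
    S = \bigcup_n [set x | x <= q n].
Proof.
move=> S0 dS; have [[b Sb]|Snb] := pselect (has_ubound S); last first.
  exists (fun n => n%:R) => [m n|]; first by rewrite ler_nat.
  apply/seteqP; split=> [x Sx|x [n _ /= xn]].
    by exists (Num.trunc x).+1 => //=; rewrite ltW// truncnS_gt.
  apply: contrapT => nSx; apply: Snb; exists x => y Sy.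
  by rewrite leNgt; apply/negP => /ltW xy; exact/nSx/(dS _ _ xy).
have hsS : has_sup S by split => //; exists b.
have [Ss|nSs] := pselect (S (sup S)).
  exists (fun=> sup S) => //; apply/seteqP; split=> [x Sx|x [_ _ /=]].
    by exists 0%N => //=; apply: ub_le_sup => //; exists b.
  by move=> /dS; exact.
exists (fun n => sup S - n.+1%:R^-1) => [m n mn|].
  by rewrite lerD2l lerN2 lef_pV2 ?posrE ?ltr0n// ler_nat ltnS.
apply/seteqP; split=> [x Sx|x [n _ /= xn]].
  have xs : x < sup S.
    rewrite lt_neqAle ub_le_sup ?andbT//; last by exists b.
    by apply/eqP => xs; apply: nSs; rewrite -xs.
  exists (Num.trunc (sup S - x)^-1) => //=.
  rewrite lerBrDr -lerBrDl -[leRHS]invrK lef_pV2 ?posrE ?invr_gt0 ?subr_gt0//.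
  exact/ltW/truncnS_gt.
have [|y Sy sy] := @sup_adherent _ S n.+1%:R^-1 _ hsS.
  by rewrite invr_gt0 ltr0n.
by apply: dS Sy; exact: (le_trans xn (ltW sy)).
Qed.

(** [F] need not be continuous, so [F (X w)] need not be uniform.  As [F] is
    nondecreasing, the event is that [X] falls in the down-set [F <= alpha], an
    increasing union of rays ending at points [q n] of this set; each ray has
    probability [F (q n) <= alpha]. *)
Lemma mu_ext_cdf_le (R : realType) (d : measure_display)
    (Omega : measurableType d) (P : probability Omega R) (X : Omega -> R)
    (F : R -> R) (alpha : R) :
  (forall r, measurable [set w | X w <= r]) ->
  (forall r, P [set w | X w <= r] = (F r)%:E) -> 0 <= alpha ->
  (mu_ext P [set w | (F (X w) <= alpha)%R] <= alpha%:E)%E.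
Proof.
move=> mX PX alpha0; pose S := [set r | F r <= alpha].
have [/set0P S0|/negP/negPn/eqP S0] := pselect (S != set0); last first.
  have -> : [set w | F (X w) <= alpha] = set0.
    by apply/seteqP; split=> // w Sw; have : S (X w) by []; rewrite S0.
  by rewrite measurable_mu_extE// measure0 lee_fin.
have dS x y : x <= y -> S y -> S x.
  move=> xy; apply: le_trans; rewrite -lee_fin -!PX.
  by apply: le_measure; rewrite ?inE// => w /= /le_trans; exact.
have [q qnd qS] := down_set_bigcup S0 dS.
have -> : [set w | F (X w) <= alpha] = \bigcup_n [set w | X w <= q n].
  rewrite -[LHS]/(X @^-1` S) qS preimage_bigcup; exact: eq_bigcupr.
have mU : measurable (\bigcup_n [set w | X w <= q n]).
  exact: bigcupT_measurable.
rewrite measurable_mu_extE//.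
have cP : P [set w | X w <= q n] @[n --> \oo] -->
    P (\bigcup_n [set w | X w <= q n]).
  apply: nondecreasing_cvg_mu => // m n mn; apply/subsetPset => w /=.
  by move=> /le_trans; apply; exact: qnd.
rewrite -[leLHS](cvg_lim (@ereal_hausdorff R) cP); apply: lime_le.
  by apply/cvg_ex; eexists; exact: cP.
apply: nearW => n; rewrite PX lee_fin.
by have : S (q n) by rewrite qS; exists n => //=.
Qed.

(** * The fused contour *)

Lemma sup_range_max (R : realType) (T : Type) (f : T -> R) (t0 : T) :
  (forall t, f t <= f t0) -> sup (range f) = f t0.
Proof.
move=> ft0; apply/eqP; rewrite eq_le; apply/andP; split.
  by apply: ge_sup => [|_ [t _ <-]//]; exists (f t0), t0.
by apply: ub_le_sup; [exists (f t0) => _ [t _ <-]|exists t0].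
Qed.

Unset Implicit Arguments.
Set Strict Implicit.

Theorem theorem1 (R : realType) (k : nat) (Theta : Type)
    (* the contours, as functions of the i-th data set *)
    (Y : 'I_k -> Type) (pi : forall i : 'I_k, Y i -> Theta -> R)
    (hpi : forall i : 'I_k, possibility_contour (pi i))
    (* the true value, and the random data sets D i under the law P *)
    (theta : Theta) (d : measure_display) (Omega : measurableType d)
    (P : probability Omega R) (D : forall i : 'I_k, Omega -> Y i)
    (hexact : forall i : 'I_k, uniform01 P (fun w => pi i (D i w) theta))
    (hindep : mutually_independent P (fun i w => pi i (D i w) theta))
    (* the combination function *)
    (gamma : 'rV[R]_k -> R)
    (hcont : {within @unit_cube R k, continuous gamma})
    (hmono : coordinatewise_monotone gamma)
    (* the uniform random vector U^k on an auxiliary probability space *)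
    (d' : measure_display) (Omega' : measurableType d')
    (P' : probability Omega' R) (U : 'I_k -> Omega' -> R)
    (hU01 : forall (i : 'I_k) (w : Omega'), 0 <= U i w <= 1)
    (hUunif : forall i : 'I_k, uniform01 P' (U i))
    (hUindep : mutually_independent P' U)
    (F : R -> R)
    (hF : F = distribution_function P' (fun w => gamma (\row_i U i w)))
    (* the maximum in the denominator exists and is positive *)
    (hmax : forall w : Omega,
      has_positive_max (combined pi gamma F (fun i => D i w))) :
  possibility_contour (fun w : Omega => fused pi gamma F (fun i => D i w)) /\
  valid P (fun w : Omega => fused pi gamma F (fun i => D i w) theta).
Proof.
pose Pi i w := pi i (D i w) theta.
have mPi i : measurable_fun setT (Pi i) by have [] := hexact i.
have mU i : measurable_fun setT (U i) by have [] := hUunif i.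
have Pi_cube w : unit_cube (\row_i Pi i w).
  by move=> i; rewrite mxE; have [Pi01 _] := hpi i; exact: Pi01.
have U_cube w : unit_cube (\row_i U i w) by move=> i; rewrite mxE.
have sublevel r : exists2 W, <<s @boxes R k >> W &
    [set w | gamma (\row_i Pi i w) <= r] = [set w | W (\row_i Pi i w)] /\
    [set w | gamma (\row_i U i w) <= r] = [set w | W (\row_i U i w)].
  have [W sW We] := sublevel_box_measurable r hcont; exists W => //.
  by split; apply/seteqP; split=> w /We; exact.
have mPiS r : measurable [set w | gamma (\row_i Pi i w) <= r].
  have [W sW [-> _]] := sublevel r.
  by have := measurable_row mPi measurableT sW; rewrite setTI.
have mUS r : measurable [set w | gamma (\row_i U i w) <= r].
  have [W sW [_ ->]] := sublevel r.
  by have := measurable_row mU measurableT sW; rewrite setTI.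
have FE r : (F r)%:E = P' [set w | gamma (\row_i U i w) <= r].
  by rewrite hF /distribution_function fineK// fin_num_measure.
have F01 r : 0 <= F r <= 1.
  by rewrite -!lee_fin FE measure_ge0 probability_le1.
have eq_law r : P [set w | gamma (\row_i Pi i w) <= r] = (F r)%:E.
  have [W sW [-> We]] := sublevel r; rewrite FE We.
  apply: eq_joint_law => // i A mA.
  by have [_ ->] := hexact i => //; have [_ ->] := hUunif i.
pose C w := combined pi gamma F (fun i => D i w).
have supC w : 0 < sup (range (C w)) <= 1 /\
    (forall t, C w t <= sup (range (C w))) /\
    exists t0, C w t0 = sup (range (C w)).
  have [t0 [Cmax C0]] := hmax w.
  rewrite (sup_range_max Cmax); split; last by split => //; exists t0.
  by rewrite C0; have /andP[] := F01 (gamma (\row_i pi i (D i w) t0)).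
split.
  split=> [w t|w]; have [/andP[M0 M1] [CM [t0 Ct0]]] := supC w.
    have /andP[C0 _] := F01 (gamma (\row_i pi i (D i w) t)).
    by rewrite divr_ge0 ?(ltW M0)//= ler_pdivrMr// mul1r; exact: CM.
  have fused_t0 : fused pi gamma F (fun i => D i w) t0 = 1.
    by rewrite /fused -/(C w) Ct0 divff// gt_eqF.
  rewrite -fused_t0; apply: sup_range_max => t.
  by rewrite fused_t0 ler_pdivrMr// mul1r; exact: CM.
move=> alpha /andP[alpha0 _].
apply: le_trans (mu_ext_cdf_le mPiS eq_law alpha0).
(* As the denominator is at most 1, the combined contour is below the fused
   one, and the event for the fused contour is contained in its event. *)
apply: le_mu_ext => w /=; apply: le_trans.
have [/andP[M0 M1] _] := supC w.
have /andP[C0 _] := F01 (gamma (\row_i Pi i w)).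
by rewrite ler_pdivlMr// ler_piMr.
Qed.
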